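(* Let $(p_{ij}\colon(X_j,\nu_j)\to(X_i,\nu_i))_{i\sqsubseteq j\in I}$ be a projective system of valued spaces, and let $X,(p_i)_{i\in I}$ be a projective limit, in the category of topological spaces, of the underlying projective system $(p_{ij}\colon X_j\to X_i)_{i\sqsubseteq j\in I}$. If $I$ has a countable cofinal subset, if every $\nu_i$ is locally finite, and if every $X_i$ is a continuous complete quasi-metric space with its $d$-Scott topology (for example a complete metric space with its open ball topology, or a Polish space), then there is a unique continuous valuation $\nu$ on $X$ such that $\nu_i=p_i[\nu]$ for every $i\in I$. Moreover, $\nu$ is tight.
   Context: For a topological space $X$, $\mathcal O X$ is its lattice of open subsets, and $\overline{\mathbb R}_+=[0,\infty]$. A valuation on $X$ is a map $\nu\colon\mathcal O X\to\overline{\mathbb R}_+$ with $\nu(\emptyset)=0$, $U\subseteq V\Rightarrow\nu(U)\le\nu(V)$, and $\nu(U\cup V)+\nu(U\cap V)=\nu(U)+\nu(V)$. It is continuous if it preserves suprema of directed families of open sets, and locally finite if every point $x\in X$ has an open neighborhood $U$ with $\nu(U)<\infty$. For $f\colon X\to Y$ continuous, $f[\nu](V)=\nu(f^{-1}(V))$ for $V\in\mathcal O Y$. A projective system of valued spaces $(p_{ij}\colon(X_j,\nu_j)\to(X_i,\nu_i))_{i\sqsubseteq j\in I}$ consists of a directed preordered set $(I,\sqsubseteq)$, topological spaces $X_i$ with continuous valuations $\nu_i$ ($i\in I$), and continuous maps $p_{ij}\colon X_j\to X_i$ for $i\sqsubseteq j$, with $p_{ii}=\mathrm{id}$, $p_{ij}\circ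 p_{jk}=p_{ik}$ for $i\sqsubseteq j\sqsubseteq k$, and $p_{ij}[\nu_j]=\nu_i$ for $i\sqsubseteq j$. A projective limit of the underlying system of spaces is its limit in the category of topological spaces; up to isomorphism it is the subspace $\{\vec x\in\prod_i X_i\mid x_i=p_{ij}(x_j)\ \forall i\sqsubseteq j\}$ of the product, with $p_i(\vec x)=x_i$. A quasi-metric on a set $X$ is a map $d\colon X\times X\to[0,\infty]$ with $d(x,x)=0$, $d(x,z)\le d(x,y)+d(y,z)$, and $d(x,y)=d(y,x)=0\Rightarrow x=y$. The poset of formal balls $\mathbf B(X,d)$ is the set of pairs $(x,r)$, $x\in X$, $r\in[0,\infty)$, ordered by $(x,r)\le(y,s)$ iff $d(x,y)\le r-s$; it is given its Scott topology. The $d$-Scott topology on $X$ is the topology induced by the injection $x\mapsto(x,0)$ into $\mathbf B(X,d)$. The quasi-metric space $X,d$ is continuous complete iff $\mathbf B(X,d)$ is a continuous dcpo. For a metric $d$, the $d$-Scott topology is the usual open ball topology, and complete metric spaces are continuous complete. A set is saturated iff it is an intersection of open sets. Compactness does not include Hausdorffness. For a map $\nu\colon\mathcal O X\to\overline{\mathbb R}_+$ and $Q\subseteq X$ compact saturated, $\nu^\bullet(Q)=\inf\{\nu(U)\mid U \text{ open},\,Q\subseteq U\}$. For $r,s\in\overline{\mathbb R}_+$, $r\ll s$ iff $r=0$ or $r<s$. The map $\nu$ is tight if for every open $U$ and every $r\ll\nu(U)$ there is a compact saturated $Q\subseteq U$ with $r\le\nu^\bullet(Q)$. *)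

(* Defs.v *)
From HB Require Import structures.
From mathcomp Require Import all_boot all_order all_algebra.
From mathcomp Require Import all_classical all_reals all_analysis.

Set Implicit Arguments.
Unset Strict Implicit.
Unset Printing Implicit Defensive.

Import Order.TTheory GRing.Theory Num.Theory.

Local Open Scope classical_set_scope.
Local Open Scope ring_scope.

Section Order.
(* The order is a bare relation: the order on formal balls depends on the
   quasi-metric, so it is not attached to the carrier type. *)
Context {T : Type} (le : T -> T -> Prop).

Definition directed (D : set T) : Prop :=
  D !=set0 /\
  forall x y, D x -> D y -> exists z, [/\ D z, le x z & le y z].

Definition is_supremum (D : set T) (s : T) : Prop :=
  (forall x, D x -> le x s) /\
  (forall u, (forall x, D x -> le x u) -> le s u).

Definition dcpo : Prop :=
  forall D, directed D -> exists s, is_supremum D s.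

Definition way_below (x y : T) : Prop :=
  forall D s, directed D -> is_supremum D s -> le y s ->
    exists2 z, D z & le x z.

Definition continuous_dcpo : Prop :=
  dcpo /\
  forall y, directed [set x | way_below x y] /\
            is_supremum [set x | way_below x y] y.

Definition scott_open (U : set T) : Prop :=
  (forall x y, U x -> le x y -> U y) /\
  (forall D s, directed D -> is_supremum D s -> U s -> D `&` U !=set0).

Definition cofinal (J : set T) : Prop :=
  forall i, exists2 j, J j & le i j.

End Order.

Section QuasiMetric.
Context {R : realType} {X : Type} (d : X -> X -> \bar R).

Definition quasi_metric : Prop :=
  [/\ forall x y, (0 <= d x y)%E,
      forall x, d x x = 0%E,
      forall x y z, (d x z <= d x y + d y z)%E
    & forall x y, d x y = 0%E -> d y x = 0%E -> x = y].

Definition formal_ball : Type := (X * {nonneg R})%type.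

Definition formal_ball_le (b c : formal_ball) : Prop :=
  (d b.1 c.1 <= (b.2%:num - c.2%:num)%R%:E)%E.

Definition continuous_complete : Prop := continuous_dcpo formal_ball_le.

Definition d_scott_open (U : set X) : Prop :=
  exists2 V : set formal_ball, scott_open formal_ball_le V &
    U = [set x | V (x, 0%:nng)].

End QuasiMetric.

Section Valuation.
(* Valuations are maps on all of [set X], of which only the values on open
   sets are meaningful. *)
Context {R : realType} {X : topologicalType}.
Local Open Scope ereal_scope.

Definition valuation (nu : set X -> \bar R) : Prop :=
  [/\ forall U, open U -> 0 <= nu U,
      nu set0 = 0,
      forall U V, open U -> open V -> U `<=` V -> nu U <= nu V
    & forall U V, open U -> open V ->
        nu (U `|` V) + nu (U `&` V) = nu U + nu V].

Definition continuous_valuation (nu : set X -> \bar R) : Prop :=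
  valuation nu /\
  forall D : set (set X), D `<=` open -> directed subset D ->
    nu (\bigcup_(U in D) U) = ereal_sup (nu @` D).

Definition locally_finite (nu : set X -> \bar R) : Prop :=
  forall x : X, exists U, [/\ open U, U x & nu U < +oo].

Definition eq_on_open (nu mu : set X -> \bar R) : Prop :=
  forall U, open U -> nu U = mu U.

Definition saturated (Q : set X) : Prop :=
  exists2 D : set (set X), D `<=` open & Q = \bigcap_(U in D) U.

Definition bullet (nu : set X -> \bar R) (Q : set X) : \bar R :=
  ereal_inf [set nu U | U in [set U | open U /\ Q `<=` U]].

Definition tight (nu : set X -> \bar R) : Prop :=
  forall U, open U ->
  forall r : \bar R, 0 <= r -> r = 0 \/ r < nu U ->
    exists Q, [/\ compact Q, saturated Q, Q `<=` U & r <= bullet nu Q].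

End Valuation.

Definition image_valuation {R : realType} {X Y : Type} (f : X -> Y)
  (nu : set X -> \bar R) : set Y -> \bar R := fun V => nu (f @^-1` V).

Section ProjectiveSystem.
Context {disp : Order.disp_t} {I : preorderType disp} (X : I -> topologicalType).
(* The bonding maps exist only for comparable indices: between unrelated
   indices there may be no map at all, one of the spaces being empty. *)
Variable p : forall i j : I, (i <= j)%O -> X j -> X i.

Definition projective_system : Prop :=
  [/\ directed (fun i j : I => (i <= j)%O) setT,
      forall i j (ij : (i <= j)%O), continuous (p ij),
      forall i (ii : (i <= i)%O), p ii =1 id
    & forall i j k (ij : (i <= j)%O) (jk : (j <= k)%O) (ik : (i <= k)%O),
        p ij \o p jk =1 p ik].

Definition projective_system_of_valued_spaces {R : realType}
    (nu : forall i, set (X i) -> \bar R) : Prop :=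
  [/\ projective_system,
      forall i, continuous_valuation (nu i)
    & forall i j (ij : (i <= j)%O),
        eq_on_open (image_valuation (p ij) (nu j)) (nu i)].

Definition cone (Y : topologicalType) (q : forall i, Y -> X i) : Prop :=
  (forall i, continuous (q i)) /\
  (forall i j (ij : (i <= j)%O), p ij \o q j =1 q i).

Definition projective_limit (Y : topologicalType) (q : forall i, Y -> X i) :
    Prop :=
  cone q /\
  forall (Z : topologicalType) (r : forall i, Z -> X i), cone r ->
    exists! h : Z -> Y, continuous h /\ (forall i, q i \o h =1 r i).

End ProjectiveSystem.

(* Main.v *)
(* A continuous complete quasi-metric space [Y] is a G-delta subspace of its
   domain of formal balls: it is the set of balls of radius less than 1/(n+1)
   for all n.  In the domain, every Scott-open set is the directed union of
   the Scott-open sets way below it, so for a continuous valuation an open set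
   of mass [> r] has a way below smaller one whose mass is still [> r].

   Along a cofinal sequence of indices, start from [r < nu_k(U)] and refine
   one coordinate after the other, each infinitely often, into a way below
   smaller open set of smaller radii, propagating each refinement to the later
   coordinates and always keeping mass [> r].  The points of the limit whose
   coordinates lie in all these open sets form a compact saturated set [Q].
   Its compactness, and the fact that any open neighbourhood of [Q] has mass
   [> r], come from a Hofmann-Mislove argument: an open set outside a
   Scott-open filter lies in a maximal one, which is prime, hence has a generic
   point by sobriety, here computed coordinatewise.

   The supremum of the masses of the basic open subsets of [V] then defines the
   limit valuation, and the existence of [Q] gives at once that it extends the
   [nu_k], is Scott-continuous, and is tight. *)

Require Import Defs.
From HB Require Import structures.
From mathcomp Require Import all_boot all_order all_algebra.
From mathcomp Require Import all_classical all_reals all_analysis.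

Set Implicit Arguments.
Unset Strict Implicit.
Unset Printing Implicit Defensive.

Import Order.TTheory GRing.Theory Num.Theory.

Local Open Scope classical_set_scope.
Local Open Scope ring_scope.

Lemma preimage_open (S T : topologicalType) (f : S -> T) (U : set T) :
  continuous f -> open U -> open (f @^-1` U).
Proof. by move=> cf; move: U; apply/continuousP. Qed.

Lemma directed1 {T : Type} (le : T -> T -> Prop) (x : T) :
  le x x -> directed le [set x].
Proof. by move=> xx; split=> [|_ _ -> ->]; exists x. Qed.

(** * Scott-open filters, prime open sets and sobriety *)

Section OpenSets.
Context {T : Type} (op : set (set T)).

Definition is_topology : Prop :=
  [/\ op setT,
      forall D, D `<=` op -> op (\bigcup_(U in D) U)
    & forall U V, op U -> op V -> op (U `&` V)].

(** The way-below relation of the lattice of open sets. *)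
Definition core_below (U V : set T) : Prop :=
  forall D, D `<=` op -> directed subset D -> V `<=` \bigcup_(W in D) W ->
    exists2 W, D W & U `<=` W.

Definition core_compact : Prop :=
  forall V y, op V -> V y -> exists U, [/\ op U, U y & core_below U V].

(* The prime open sets are the complements of the irreducible closed sets;
   [sober] asks for a generic point of each of them, not for its
   uniqueness. *)
Definition prime_open (W : set T) : Prop :=
  [/\ op W, W <> setT
    & forall U V, op U -> op V -> U `&` V `<=` W -> U `<=` W \/ V `<=` W].

Definition sober : Prop :=
  forall W, prime_open W -> exists x, forall U, op U -> U x <-> ~ U `<=` W.

Definition scott_filter (F : set (set T)) : Prop :=
  [/\ F setT,
      forall U V, F U -> U `<=` V -> op V -> F V,
      forall U V, F U -> F V -> F (U `&` V)
    & forall D, D `<=` op -> directed subset D -> F (\bigcup_(U in D) U) ->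
        exists2 U, D U & F U].

Hypothesis opP : is_topology.

Lemma op_setU U V : op U -> op V -> op (U `|` V).
Proof.
case: opP => _ opU _ oU oV.
have -> : U `|` V = \bigcup_(W in [set W | W = U \/ W = V]) W.
  rewrite eqEsubset; split=> [x [Ux|Vx]|x [W [->|->] Wx]].
  - by exists U => //; left.
  - by exists V => //; right.
  - by left.
  - by right.
by apply: opU => W [->|->].
Qed.

(** By Scott-openness, open sets outside [F] are stable under unions of chains, so Zorn's lemma
    gives a maximal one, [M]. If neither [U] nor [V] lies in [M], their unions with [M] belong to
    [F], hence so does the intersection of these unions; it would be [M] if [M] contained the
    intersection of [U] and [V]. *)
Lemma scott_filter_prime (F : set (set T)) (W : set T) :
  scott_filter F -> op W -> ~ F W ->
  exists M, [/\ prime_open M, W `<=` M, ~ F M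
              & forall U, op U -> ~ U `<=` M -> F (U `|` M)].
Proof.
case=> FT Fup FI Fscott oW nFW; case: (opP) => oT oU oI.
(* The predicate adds [W] to [A] instead of asking [A] to contain [W], because the empty chain has
   union [set0]. *)
have [|A [[oA nFA] Amax]] :=
    @Zorn_bigcup T [set A | op A /\ ~ F (A `|` W)].
  move=> C CP totC; split; first by apply: oU => A /CP[].
  have [[A0 CA0]|C0] := pselect (exists A, C A); last first.
    rewrite (_ : \bigcup_(X in C) X = set0) ?set0U//.
    by rewrite -subset0 => x [A CA]; exfalso; apply: C0; exists A.
  have -> : \bigcup_(X in C) X `|` W =
            \bigcup_(X in [set A `|` W | A in C]) X.
    rewrite eqEsubset; split=> [x [[A CA Ax]|Wx]|x [_ [A CA <-] [Ax|Wx]]].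
    - by exists (A `|` W); [exists A|left].
    - by exists (A0 `|` W); [exists A0|right].
    - by left; exists A.
    - by right.
  move=> /Fscott[].
  - by move=> _ [A /CP[oA _] <-]; exact: op_setU.
  - split; first by exists (A0 `|` W); exists A0.
    move=> _ _ [A CA <-] [B CB <-].
    have [AB|BA] := totC _ _ CA CB.
    + by exists (B `|` W); split=> //; [exists B|exact: setSU].
    + by exists (A `|` W); split=> //; [exists A|exact: setSU].
  - by move=> _ [A /CP[_ nF] <-].
have big U : op U -> ~ U `<=` A `|` W -> F (U `|` (A `|` W)).
  move=> oU' UA; apply: contrapT => nF.
  apply: (Amax (A `|` U)).
    split; first by left.
    by move=> AUA; apply: UA => x Ux; left; apply: AUA; right.
  split; first exact: op_setU.
  by rewrite setUAC setUC.
exists (A `|` W); split=> //.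
split; [exact: op_setU|by move=> E; apply: nFA; rewrite E|].
move=> U V oU' oV UV; apply: contrapT => /not_orP[nU nV]; apply: (nFA).
have := FI _ _ (big _ oU' nU) (big _ oV nV).
rewrite -setUIl; move/Fup; apply; last exact: op_setU.
by rewrite subUset; split.
Qed.

Lemma core_below_sub U V : op V -> core_below U V -> U `<=` V.
Proof.
move=> oV /(_ [set V])[].
- by move=> _ ->.
- exact: directed1.
- by move=> x Vx; exists V.
- by move=> _ ->.
Qed.

Lemma core_below0 V : core_below set0 V.
Proof. by move=> D _ [[W DW] _] _; exists W. Qed.

Lemma core_belowU U1 U2 V :
  core_below U1 V -> core_below U2 V -> core_below (U1 `|` U2) V.
Proof.
move=> b1 b2 D Dop dD VD.
have [W1 DW1 s1] := b1 D Dop dD VD; have [W2 DW2 s2] := b2 D Dop dD VD.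
have [W [DW s1' s2']] := dD.2 _ _ DW1 DW2; exists W => //.
by rewrite subUset; split; [exact: subset_trans s1 s1'|
                            exact: subset_trans s2 s2'].
Qed.

(* Well-filteredness of decreasing sequences, the sober substitute for the
   nonemptiness of decreasing intersections of compact sets. *)
Lemma core_below_capn (G : nat -> set T) (W : set T) :
  sober -> (forall n, op (G n)) ->
  (forall m n, (m <= n)%N -> G n `<=` G m) ->
  (forall n, exists2 m, (n <= m)%N & core_below (G m.+1) (G m)) ->
  op W -> \bigcap_n G n `<=` W -> exists n, G n `<=` W.
Proof.
move=> sob oG Gdec Gbelow oW GW; apply: contrapT => nGW.
(* Scott-openness of this filter: a directed cover of [G m] has, for suitable [m], a member
   containing [G m.+1]. The generic point of a prime open set outside the filter lies in every
   [G n]. *)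
have [||M [pM WM nGM _]] :=
    @scott_filter_prime [set U | exists n, G n `<=` U] W _ oW.
- split.
  + by exists 0%N.
  + by move=> U V [n GU] UV _; exists n; exact: subset_trans UV.
  + move=> U V [m Um] [n Vn]; exists (maxn m n); rewrite subsetI; split.
      by apply: subset_trans Um; apply: Gdec; exact: leq_maxl.
    by apply: subset_trans Vn; apply: Gdec; exact: leq_maxr.
  + move=> D Dop dD [n GD]; have [m nm /(_ D Dop dD)[|U DU GU]] := Gbelow n.
      exact: subset_trans (Gdec _ _ nm) GD.
    by exists U => //; exists m.+1.
- by [].
have [x xM] := sob _ pM.
have Gx : (\bigcap_n G n) x.
  by move=> n _; apply/(xM _ (oG n)) => GM; apply: nGM; exists n.
by have /(_ WM) := (xM _ oW).1 (GW _ Gx).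
Qed.

End OpenSets.

(** * The Scott topology of a continuous dcpo *)

Section ScottTopology.
Context {T : Type} (le : T -> T -> Prop).
Hypothesis le_refl : forall x, le x x.
Hypothesis le_trans : forall x y z, le x y -> le y z -> le x z.
Hypothesis cont : continuous_dcpo le.

Lemma scott_topology : is_topology (scott_open le).
Proof.
split.
- by split=> // D s [[x Dx] _] _ _; exists x.
- move=> C Cop; split=> [x y [U CU Ux] xy|D s dD sD [U CU Us]].
    by exists U => //; apply: (Cop _ CU).1 xy.
  by have [x [Dx Ux]] := (Cop _ CU).2 _ _ dD sD Us; exists x; split=> //;
      exists U.
- move=> U V [Uup Usc] [Vup Vsc]; split=> [x y [Ux Vx] xy|D s dD sD [Us Vs]].
    by split; [apply: Uup xy|apply: Vup xy].
  have [x [Dx Ux]] := Usc _ _ dD sD Us; have [y [Dy Vy]] := Vsc _ _ dD sD Vs.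
  have [z [Dz xz yz]] := dD.2 _ _ Dx Dy.
  by exists z; split=> //; split; [apply: Uup xz|apply: Vup yz].
Qed.

Lemma way_below_le x y : way_below le x y -> le x y.
Proof.
move=> /(_ [set y] y)[]//.
- exact: directed1.
- by split=> [_ ->//|u]; apply.
- by move=> _ ->.
Qed.

Lemma way_below_le_trans x y z : way_below le x y -> le y z -> way_below le x z.
Proof. by move=> xy yz D s dD sD zs; apply: xy dD sD _; exact: le_trans zs. Qed.

Lemma le_way_below_trans x y z : le x y -> way_below le y z -> way_below le x z.
Proof.
move=> xy yz D s dD sD zs; have [w Dw yw] := yz D s dD sD zs.
by exists w => //; exact: le_trans yw.
Qed.

(** The points way below some point way below [y] form a directed set with supremum [y], so one of
    them is above [x]. *)
Lemma way_below_interpolation x y :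
  way_below le x y -> exists2 z, way_below le x z & way_below le z y.
Proof.
move=> xy; case: cont => _ bel.
have [[w wy] dy] := (bel y).1.
have [_ suby] := bel y.
pose D := [set a | exists2 b, way_below le b y & way_below le a b].
have [||z [b by_ zb] xz] := xy D y _ _ (le_refl y).
- split; first by have [[[v vw] _] _] := bel w; exists v, w.
  move=> a a' [b bly ab] [b' b'ly ab'].
  have [c [cy bc b'c]] := dy _ _ bly b'ly.
  have [e [ec ae a'e]] := (bel c).1.2 _ _ (way_below_le_trans ab bc)
                                          (way_below_le_trans ab' b'c).
  by exists e; split=> //; exists c.
- split=> [a [b bly ab]|u ubu].
    exact: le_trans (way_below_le ab) (way_below_le bly).
  apply: suby.2 => b bly; apply: (bel b).2.2 => a ab.
  by apply: ubu; exists b.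
by exists b => //; exact: le_way_below_trans zb.
Qed.

Lemma scott_open_way_below x : scott_open le [set y | way_below le x y].
Proof.
split=> [y z /= xy yz|D s dD sD /= xs]; first exact: way_below_le_trans yz.
have [z xz zs] := way_below_interpolation xs.
have [w Dw zw] := zs D s dD sD (le_refl s).
by exists w; split=> //=; exact: way_below_le_trans zw.
Qed.

Lemma scott_open_approx (U : set T) (y : T) :
  scott_open le U -> U y -> exists2 x, U x & way_below le x y.
Proof.
move=> [_ Usc] Uy; have [x [xy Ux]] := Usc _ _ (cont.2 y).1 (cont.2 y).2 Uy.
by exists x.
Qed.

(** In a cover of [V], the member containing [x] already contains every point that [x] is way
    below. *)
Lemma scott_core_compact : core_compact (scott_open le).
Proof.
move=> V y oV Vy; have [x Vx xy] := scott_open_approx oV Vy.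
exists [set z | way_below le x z]; split=> //.
  exact: scott_open_way_below.
move=> D Dop _ /(_ _ Vx)[W DW Wx]; exists W => // z /= xz.
by apply: (Dop _ DW).1 Wx _; exact: way_below_le.
Qed.

(** The generic point is the supremum of the points way below some point outside [W]; primality of
    [W] makes this family directed. *)
Lemma scott_sober : sober (scott_open le).
Proof.
move=> W [[Wup Wsc] WT Wprime].
pose D := [set e | ~ [set y | way_below le e y] `<=` W].
have Dwit e : D e -> exists2 c, ~ W c & way_below le e c.
  move=> De; apply: contrapT => nc; apply: De => c /= ec.
  by apply: contrapT => Wc; apply: nc; exists c.
have Dmem e c : ~ W c -> way_below le e c -> D e.
  by move=> Wc ec /(_ _ ec).
have [c0 Wc0] : exists c, ~ W c.
  by apply/existsNP => WA; apply: WT; rewrite eqEsubset; split.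
have dD : directed le D.
  split.
    by have [[[e ec] _] _] := cont.2 c0; exists e; exact: Dmem ec.
  move=> e e' De De'.
  have [c [Wc ec e'c]] :
      exists c, [/\ ~ W c, way_below le e c & way_below le e' c].
    apply: contrapT => nc.
    have [|//|//] :=
      Wprime _ _ (scott_open_way_below e) (scott_open_way_below e').
    move=> c [/= ec e'c]; apply: contrapT => Wc.
    by apply: nc; exists c.
  have [f [fc ef e'f]] := (cont.2 c).1.2 _ _ ec e'c.
  by exists f; split=> //; exact: Dmem fc.
have [s sD] := cont.1 _ dD; exists s => U oU; split.
  move=> Us; have [e [De Ue]] := oU.2 _ _ dD sD Us.
  move=> UW; apply: De => c /= ec; apply: UW.
  by apply: oU.1 Ue _; exact: way_below_le.
move=> UW; have [c [Uc Wc]] : exists c, U c /\ ~ W c.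
  apply: contrapT => nc; apply: UW => c Uc; apply: contrapT => Wc.
  by apply: nc; exists c.
have [e Ue ec] := scott_open_approx oU Uc.
by apply: oU.1 Ue _; apply: sD.1; exact: Dmem ec.
Qed.

End ScottTopology.

(* A presentation of [Y] as a G-delta subspace of a locally compact sober
   space [carrier], whose topology [op] is kept as a bare family of sets. *)
Record lcs_presentation (Y : topologicalType) := LcsPresentation {
  carrier : Type;
  op : set (set carrier);
  emb : Y -> carrier;
  layer : nat -> set carrier;
  op_topology : is_topology op;
  op_core_compact : core_compact op;
  op_sober : sober op;
  op_layer : forall n, op (layer n);
  layer_dec : forall m n, (m <= n)%N -> layer n `<=` layer m;
  layer_emb : forall n y, layer n (emb y);
  layers_emb : forall s, (forall n, layer n s) -> exists y, emb y = s;
  open_emb : forall U : set Y, open U <-> exists2 O, op O & U = emb @^-1` O;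
  emb_T0 : forall x y, (forall U : set Y, open U -> U x <-> U y) -> x = y }.

Arguments op_topology {Y} l.
Arguments op_core_compact {Y} l [V y] _ _.
Arguments op_sober {Y} l [W] _.
Arguments op_layer {Y} l n.
Arguments layer_dec {Y} l [m n] _ _ _.
Arguments op {Y} l _.
Arguments emb {Y} l _.
Arguments layer {Y} l n _.
Arguments layers_emb {Y} l s _.

(** * Formal balls of a continuous complete quasi-metric space *)

Section FormalBalls.
Context {R : realType} {Y : topologicalType} (d : Y -> Y -> \bar R).
Hypothesis qd : quasi_metric d.
Hypothesis cd : continuous_complete d.
Hypothesis openP : forall U : set Y, open U <-> d_scott_open d U.

Local Notation fball := (@formal_ball R Y).
Let le := formal_ball_le d.

Lemma formal_ball_le_refl b : le b b.
Proof. by case: qd => _ d0 _ _; rewrite /le /formal_ball_le d0 subrr. Qed.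

Lemma formal_ball_le_trans a b c : le a b -> le b c -> le a c.
Proof.
case: qd => _ _ dtri _ ab bc; rewrite /le /formal_ball_le.
apply: le_trans (dtri _ b.1 _) _; apply: le_trans (leeD ab bc) _.
by rewrite -EFinD lee_fin addrA subrK.
Qed.

Lemma formal_ball_le_radius a b : le a b -> b.2%:num <= a.2%:num.
Proof.
case: qd => d0 _ _ _ ab.
by rewrite -subr_ge0 -lee_fin; exact: le_trans (d0 _ _) ab.
Qed.

(* Translating a directed family by [eps] and taking the supremum of the
   result shows that radii do not drop at suprema: standardness of [d]. *)
Lemma radius_supremum_ge (D : set (fball)) s (eps : R) :
  0 <= eps -> directed le D -> is_supremum le D s ->
  (forall b, D b -> eps <= b.2%:num) -> eps <= s.2%:num.
Proof.
move=> eps0 dD sD Deps.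
pose D' := [set c : fball |
  exists2 b, D b & c.1 = b.1 /\ c.2%:num = b.2%:num - eps].
have D'of b : D b -> exists2 c : fball,
    D' c & c.1 = b.1 /\ c.2%:num = b.2%:num - eps.
  move=> Db; have h : 0 <= b.2%:num - eps by rewrite subr_ge0 Deps.
  by exists (b.1, NngNum h) => //; exists b.
have shift (b c b' c' : fball) :
    c.1 = b.1 /\ c.2%:num = b.2%:num - eps ->
    c'.1 = b'.1 /\ c'.2%:num = b'.2%:num - eps -> le b b' -> le c c'.
  move=> [e1 e2] [e1' e2']; rewrite /le /formal_ball_le e1 e2 e1' e2'.
  by rewrite opprB addrA subrK.
have [|t [ubt _]] := cd.1 D'.
  split; first by have [[b /D'of[c D'c _]] _] := dD; exists c.
  move=> c c' [b Db cb] [b' Db' cb'].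
  have [b'' [Db'' bb'' b'b'']] := dD.2 _ _ Db Db'.
  have [c'' D'c'' cb''] := D'of _ Db''.
  by exists c''; split=> //; [exact: shift bb''|exact: shift b'b''].
(* Adding [eps] back to the radius of [t] gives an upper bound of [D], hence a ball above [s], of
   radius at least [eps]. *)
have h : 0 <= t.2%:num + eps by rewrite addr_ge0.
have /formal_ball_le_radius /= : le s (t.1, NngNum h).
  apply: sD.2 => b Db; have [c D'c [c1 c2]] := D'of _ Db.
  have := ubt _ D'c; rewrite /le /formal_ball_le /= c1 c2.
  by rewrite opprD [- _ - eps]addrC addrA.
by apply: le_trans; rewrite lerDr.
Qed.

Lemma scott_open_small_radius n :
  scott_open le [set b | b.2%:num < n.+1%:R^-1].
Proof.
split=> [b c /= bn bc|D s dD sD /= sn].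
  by apply: le_lt_trans bn; exact: formal_ball_le_radius.
apply: contrapT => nD; move: sn; apply/negP; rewrite -leNgt.
apply: radius_supremum_ge dD sD _ => //.
move=> b Db; rewrite leNgt; apply/negP => bn.
by apply: nD; exists b.
Qed.

Lemma small_radius_dec m n : (m <= n)%N ->
  [set b : fball | b.2%:num < n.+1%:R^-1] `<=`
  [set b | b.2%:num < m.+1%:R^-1].
Proof.
move=> mn b /= /lt_le_trans; apply.
by rewrite lef_pV2 ?posrE ?ltr0n// ler_nat ltnS.
Qed.

Lemma small_radius_center (b : fball) :
  (forall n, b.2%:num < n.+1%:R^-1) -> exists y, (y, 0%:nng) = b.
Proof.
move=> bn; exists b.1; case: b bn => y r /= rn; congr pair.
apply/val_inj => /=; apply/eqP; rewrite eq_le; apply/andP; split=> //.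
apply/ler_addgt0Pl => e e0; rewrite addr0.
have [n _ /(_ n (leqnn n)) ne] := near_infty_natSinv_lt (PosNum e0).
exact/ltW/(lt_trans (rn n)).
Qed.

(** If every open set containing [u] contains [v], then each ball way below [(u, 0)] is way below
    [(v, 0)]. Taking suprema, [(u, 0)] is below [(v, 0)], that is, [d u v = 0]. *)
Lemma quasi_metric_T0 (x y : Y) :
  (forall U, open U -> U x <-> U y) -> x = y.
Proof.
have T0_le (u v : Y) : (forall U, open U -> U u -> U v) -> d u v = 0%E.
  move=> uv; have : le (u, 0%:nng) (v, 0%:nng).
    apply: (cd.2 (u, 0%:nng)).2.2 => e eu; apply: way_below_le.
      exact: formal_ball_le_refl.
    have := uv [set z | way_below le e (z, 0%:nng)]; apply=> //.
    apply/openP; exists [set c | way_below le e c] => //.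
    apply: scott_open_way_below => //.
    - exact: formal_ball_le_refl.
    - exact: formal_ball_le_trans.
  rewrite /le /formal_ball_le /= subrr => duv.
  by apply/eqP; rewrite eq_le duv; case: qd => ->.
move=> xy; case: qd => _ _ _; apply; apply: T0_le => U oU;
  by have [] := xy _ oU.
Qed.

Definition formal_ball_presentation : lcs_presentation Y :=
  @LcsPresentation Y fball (scott_open le)
    (fun y => (y, 0%:nng)) (fun n => [set b | b.2%:num < n.+1%:R^-1])
    (scott_topology le)
    (scott_core_compact formal_ball_le_refl formal_ball_le_trans cd)
    (scott_sober formal_ball_le_refl formal_ball_le_trans cd)
    scott_open_small_radius small_radius_dec
    (fun n y => ltac:(by rewrite /= invr_gt0))
    small_radius_center openP quasi_metric_T0.

End FormalBalls.

(** * Sobriety of presented spaces *)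

Section LcsComplete.
Context {Y : topologicalType} (P : lcs_presentation Y).

Local Notation trace := (preimage (emb P)).

Lemma trace_open O : op P O -> open (trace O).
Proof. by move=> oO; apply/(open_emb P); exists O. Qed.

(** The largest open set of the carrier with trace inside [W] is prime. Its generic point lies in
    every layer, because a layer has full trace, and so it comes from [Y]. *)
Lemma lcs_sober : sober (@open Y).
Proof.
move=> W [oW WT Wprime]; have [opT opU opI] := op_topology P.
pose W' := \bigcup_(O in [set O | op P O /\ trace O `<=` W]) O.
have subW' O : op P O -> O `<=` W' <-> trace O `<=` W.
  move=> oO; split=> [OW' y /OW'[U [_ UW]]|OW s Os]; first exact: UW.
  by exists O.
have [|s sW'] := op_sober P (W := W').
  split; first by apply: opU => O [].
    move=> W'T; apply: WT; rewrite -subTset => y _.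
    have : W' (emb P y) by rewrite W'T.
    by move=> [U [_ UW]]; exact: UW.
  move=> U V oU oV /(subW' _ (opI _ _ oU oV)); rewrite preimage_setI.
  move=> /Wprime[| |UW|VW]; [exact: trace_open|exact: trace_open|left|right];
    exact/subW'.
have [n|y ys] := layers_emb P s.
  apply/sW'; first exact: op_layer.
  move/subW'; move/(_ (op_layer P n)) => LW; apply: WT.
  by rewrite eqEsubset; split=> // y _; apply: LW; exact: layer_emb.
exists y => U /(open_emb P)[V oV ->].
by rewrite /= ys -subW'//; exact: sW'.
Qed.

End LcsComplete.

(** If a filter containing [Q] had no cluster point in [Q], the open sets disjoint from some member
    of it would be a directed cover of [Q]; one of them would contain [Q]. *)
Lemma compact_directed (T : topologicalType) (Q : set T) :
  (forall D : set (set T), D `<=` open -> directed subset D ->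
    Q `<=` \bigcup_(U in D) U -> exists2 U, D U & Q `<=` U) ->
  compact Q.
Proof.
move=> Qcover F PF FQ; apply: contrapT => Q0.
have [|||U [_ [B FB UB]] QU] :=
    Qcover [set U | open U /\ exists2 B, F B & U `&` B = set0].
- by move=> U [].
- split; first by exists set0; split; [exact: open0|exists Q; rewrite ?set0I].
  move=> U V [oU [A FA UA]] [oV [B FB VB]]; exists (U `|` V).
  split=> //; split; first exact: openU.
  exists (A `&` B); first exact: filterI.
  by rewrite -subset0 => x [[Ux|Vx] [Ax Bx]]; [rewrite -UA|rewrite -VB].
- move=> x Qx; apply: contrapT => nx; apply: Q0; exists x; split=> // A B FA.
  rewrite nbhsE => -[U [oU Ux] UB]; apply: contrapT => AB0; apply: nx.
  exists U => //; split=> //; exists A => //.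
  by rewrite -subset0 => y [Uy Ay]; apply: AB0; exists y; split=> //; exact: UB.
have [x [Qx Bx]] := filter_ex (filterI FQ FB).
suff : set0 x by [].
by rewrite -UB; split=> //; exact: QU.
Qed.

(** * Projective sequences of presented spaces *)

Section ProjectiveSequence.
Context {R : realType} (Y : nat -> topologicalType)
  (q : forall m n, (m <= n)%N -> Y n -> Y m)
  (nu : forall n, set (Y n) -> \bar R)
  (X : topologicalType) (pi : forall n, X -> Y n)
  (P : forall n, lcs_presentation (Y n)).
Arguments q {m n}.
Arguments nu : clear implicits.

Hypothesis q_cont : forall m n (mn : (m <= n)%N), continuous (q mn).
Hypothesis q_id : forall n (nn : (n <= n)%N) y, q nn y = y.
Hypothesis q_comp : forall l m n (lm : (l <= m)%N) (mn : (m <= n)%N)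
  (ln : (l <= n)%N) y, q lm (q mn y) = q ln y.
Hypothesis nu_cont : forall n, continuous_valuation (nu n).
Hypothesis nu_q : forall m n (mn : (m <= n)%N),
  eq_on_open (image_valuation (q mn) (nu n)) (nu m).
Hypothesis pi_cont : forall n, continuous (pi n).
Hypothesis pi_q : forall m n (mn : (m <= n)%N) x, q mn (pi n x) = pi m x.
(** Instead of its universal property, the limit is given by its points, the compatible sequences,
    and its base of cylinders. *)
Hypothesis pi_point : forall y : forall n, Y n,
  (forall m n (mn : (m <= n)%N), q mn (y n) = y m) ->
  exists x, forall n, pi n x = y n.
Hypothesis pi_base : forall (W : set X) x, open W -> W x ->
  exists n (U : set (Y n)), [/\ open U, U (pi n x) & pi n @^-1` U `<=` W].

Let q_open m n (mn : (m <= n)%N) U : open U -> open (q mn @^-1` U).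
Proof. exact: preimage_open. Qed.

Let pi_open n U : open U -> open (pi n @^-1` U).
Proof. exact: preimage_open. Qed.

Let nu_le n U V : open U -> open V -> U `<=` V -> (nu n U <= nu n V)%E.
Proof. by case: (nu_cont n) => -[_ _ + _] _; apply. Qed.

(* A [tel_open] set of points of the disjoint union of the [Y n] stands for
   the open set [realize W] of the limit (below), but being a union of slices
   it does not depend on which points the limit has. *)
Let tel := {n & Y n}.

Definition slice (W : set tel) n : set (Y n) := [set y | W (existT _ n y)].
Arguments slice : clear implicits.

Definition tel_open (W : set tel) : Prop :=
  (forall n, open (slice W n)) /\
  (forall m n (mn : (m <= n)%N), q mn @^-1` slice W m `<=` slice W n).

Definition raise n (U : set (Y n)) : set tel :=
  [set t | exists nt : (n <= tag t)%N, U (q nt (tagged t))].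

Lemma tel_topology : is_topology tel_open.
Proof.
split.
- by split=> // n; exact: openT.
- move=> D Dop; split=> [n|m n mn y [W DW Wy]].
    by apply: bigcup_open => W /Dop[].
  by exists W => //; exact: (Dop _ DW).2 Wy.
- move=> U V [oU qU] [oV qV]; split=> [n|m n mn y [Uy Vy]].
    exact: openI.
  by split; [exact: qU Uy|exact: qV Vy].
Qed.

Lemma slice_raise n U m (nm : (n <= m)%N) : slice (raise U) m = q nm @^-1` U.
Proof.
rewrite eqEsubset; split=> y /=; last by exists nm.
by move=> [nm' /=]; rewrite (bool_irrelevance nm' nm).
Qed.

Lemma slice_raise0 n (U : set (Y n)) m : (m < n)%N -> slice (raise U) m = set0.
Proof.
move=> mn; rewrite -subset0 => y [/= nm _].
by move: (leq_trans mn nm); rewrite ltnn.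
Qed.

Lemma tel_open_raise n (U : set (Y n)) : open U -> tel_open (raise U).
Proof.
move=> oU; split=> [m|l m lm y].
  have [nm|mn] := leqP n m; first by rewrite slice_raise; exact: q_open.
  by rewrite slice_raise0//; exact: open0.
move=> [/= nl Uy]; exists (leq_trans nl lm) => /=.
by move: Uy; rewrite /= (q_comp _ _ (leq_trans nl lm)).
Qed.

Lemma pi_slice (W : set tel) m n x : tel_open W -> (m <= n)%N ->
  slice W m (pi m x) -> slice W n (pi n x).
Proof. by move=> [_ qW] mn Wx; apply: (qW _ _ mn); rewrite /= pi_q. Qed.

Local Notation trace n := (preimage (emb (P n))).

(** * Successive refinement of the coordinates *)

Section Refinement.
Variable r : \bar R.

(** One stage of the refinement: from [N] on, the traces are mere pullbacks, hence all of the same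
    mass above [r]. *)
Definition admissible (G : forall n, set (carrier (P n))) : Prop :=
  [/\ forall n, op (P n) (G n),
      forall m n (mn : (m <= n)%N),
        trace n (G n) `<=` q mn @^-1` trace m (G m)
    & exists N, (r < nu N (trace N (G N)))%E /\
        forall n (Nn : (N <= n)%N),
          trace n (G n) = q Nn @^-1` trace N (G N)].

(** At a level past both [N] and [n], the trace has mass above [r] and lies in the pullback of the
    trace at [n]. *)
Lemma admissible_mass G n : admissible G -> (r < nu n (trace n (G n)))%E.
Proof.
move=> [oG Gq [N [rN stN]]].
have NM := leq_maxl N n; have nM := leq_maxr N n.
have oGn m : open (trace m (G m)) by exact: trace_open.
apply: lt_le_trans rN _; rewrite -(nu_q NM)// /image_valuation -stN.
by rewrite -(nu_q nM)//; apply: nu_le => //; exact: q_open.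
Qed.

Lemma admissible_start k (U : set (Y k)) : open U -> (r < nu k U)%E ->
  exists2 G, admissible G & trace k (G k) `<=` U.
Proof.
move=> oU rU.
(* From [k] on, pull [U] back; before [k], impose nothing. *)
have /(_ _)/cid-/all_sig[G GP] n : exists V, [/\ op (P n) V,
    (forall kn : (k <= n)%N, trace n V = q kn @^-1` U)
    & ((n < k)%N -> V = setT)].
  have /orP[kn|nk] := leqVgt k n.
    have [V oV VU] := (open_emb (P n) _).1 (q_open kn oU).
    exists V; split=> // [kn'|]; first by rewrite -VU (bool_irrelevance kn' kn).
    by rewrite ltnNge kn.
  exists setT; split=> //; first by case: (op_topology (P n)).
  by move=> kn; move: (leq_trans nk kn); rewrite ltnn.
exists G; last first.
  by have [_ /(_ (leqnn k)) -> _] := GP k => y /=; rewrite q_id.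
split; first by move=> n; have [] := GP n.
  move=> m n mn y Gy; have [_ Gm GmT] := GP m.
  have /orP[km|mk] := leqVgt k m; last by rewrite /= GmT.
  rewrite Gm.
  have [_ Gn _] := GP n; move: Gy; rewrite (Gn (leq_trans km mn)) /=.
  by rewrite (q_comp _ _ (leq_trans km mn)).
have [_ Gk _] := GP k.
have GkU : trace k (G k) = U.
  by rewrite Gk; rewrite eqEsubset; split=> y /=; rewrite q_id.
exists k; split; first by rewrite GkU.
by move=> n kn; have [_ -> _] := GP n; rewrite GkU.
Qed.

Lemma admissible_refine G k j : admissible G ->
  exists G', [/\ admissible G', forall n, G' n `<=` G n,
    core_below (op (P k)) (G' k) (G k) & G' k `<=` layer (P k) j].
Proof.
move=> [oG Gq [N [rN stN]]].
(* Past [N] the mass is constant, and past [k] the refined coordinate can be pulled back: mass is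
   measured at [M]. *)
pose M := maxn N k.
have NM : (N <= M)%N := leq_maxl N k; have kM : (k <= M)%N := leq_maxr N k.
have [opT opU opI] := op_topology (P k).
have oL : op (P k) (G k `&` layer (P k) j) by apply: opI => //; exact: op_layer.
pose A := trace M (G M).
have oA : open A by exact: trace_open.
have rA : (r < nu M A)%E.
  rewrite /A (stN _ NM) -[nu _ _]/(image_valuation _ _ _) nu_q//.
  exact: trace_open.
pose B O := A `&` q kM @^-1` trace k O.
pose small O := op (P k) O /\ core_below (op (P k)) O (G k `&` layer (P k) j).
have oB O : op (P k) O -> open (B O).
  by move=> oO; apply: openI => //; apply: q_open; exact: trace_open.
(* By core-compactness [A] is the directed union of the sets [B V] with [V] small, so continuity of
   [nu M] finds one that keeps mass above [r]. *)
have [V [oV bV] rV] : exists2 V, small V & (r < nu M (B V))%E.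
  have AE : A = \bigcup_(V in B @` small) V.
    rewrite eqEsubset; split=> [y Ay|y [_ [U _ <-] []//]].
    have [|V [oV Vy bV]] := op_core_compact (P k) (y := emb (P k) (q kM y)) oL.
      by split; [exact: (Gq _ _ kM)|exact: layer_emb].
    by exists (B V) => //; exists V.
  have := rA; rewrite {1}AE (nu_cont M).2.
  - by move=> /ereal_sup_gt[_ [_ [V sV <-] <-] rV]; exists V.
  - by move=> _ [U [oU _] <-]; exact: oB.
  - split.
      exists (B set0), set0 => //; split; last exact: core_below0.
      by rewrite -(bigcup_set0 id); exact: opU.
    move=> _ _ [U [oU bU] <-] [V [oV bV] <-].
    exists (B (U `|` V)); split.
    + exists (U `|` V) => //; split; first exact: op_setU.
      exact: core_belowU.
    + by move=> y [Ay Uy]; split=> //; left.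
    + by move=> y [Ay Vy]; split=> //; right.
have VL := core_below_sub oL bV.
(* Coordinates before [k] are kept, coordinate [k] becomes [V], and later ones are cut down by the
   pullback of [V]. *)
have /(_ _)/cid-/all_sig[H HP] n : exists W, [/\ op (P n) W, W `<=` G n,
    (forall kn : (k <= n)%N,
       trace n W = trace n (G n) `&` q kn @^-1` trace k V),
    ((n < k)%N -> W = G n)
    & n = k -> core_below (op (P n)) W (G n) /\ W `<=` layer (P n) j].
  have [kn|kn|nk] : [\/ k = n, (k < n)%N | (n < k)%N].
    by case: (ltngtP k n) => ?; [constructor 2|constructor 3|constructor 1].
  - subst n; exists V; split=> //.
    + by move=> y /VL[].
    + move=> kk; rewrite eqEsubset; split=> y /=; rewrite q_id; last by case.
      by move=> Vy; split=> //; have [] := VL _ Vy.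
    + by rewrite ltnn.
    + move=> _; split; last by move=> y /VL[].
      move=> D Dop dD GD; apply: bV => //.
      by apply: subset_trans GD => y [].
  - have [W oW WV] := (open_emb (P n) _).1 (q_open (ltnW kn) (trace_open oV)).
    have [_ _ opIn] := op_topology (P n).
    exists (G n `&` W); split=> //.
    + exact: opIn.
    + move=> kn'; rewrite preimage_setI -WV.
      by rewrite (bool_irrelevance kn' (ltnW kn)).
    + by rewrite ltnNge (ltnW kn).
    + by move=> nk; have := kn; rewrite {1}nk ltnn.
  - exists (G n); split=> // [kn|nk'].
      by move: (leq_trans nk kn); rewrite ltnn.
    by move: nk; rewrite nk' ltnn.
exists H; split.
- split; first by move=> n; have [] := HP n.
  + move=> m n mn y Hy.
    have [_ _ Hm Hm' _] := HP m; have [_ Hn HnV _ _] := HP n.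
    have Gy : (q mn @^-1` trace m (G m)) y by apply: Gq; exact: Hn.
    have /orP[km|mk] := leqVgt k m; last by rewrite /= Hm'.
    rewrite Hm; split=> //=.
    have kn := leq_trans km mn.
    by move: Hy; rewrite (HnV kn) => -[_]; rewrite /= (q_comp _ _ kn).
  + have [_ _ HM _ _] := HP M.
    exists M; split; first by rewrite (HM kM).
    move=> n Mn; have [_ _ Hn _ _] := HP n.
    have qq l (lM : (l <= M)%N) (ln : (l <= n)%N) Z :
        q Mn @^-1` (q lM @^-1` Z) = q ln @^-1` Z.
      by rewrite eqEsubset; split=> y /=; rewrite (q_comp _ _ ln).
    rewrite (HM kM) (Hn (leq_trans kM Mn)) (stN _ (leq_trans NM Mn)).
    by rewrite (stN _ NM) preimage_setI !(qq _ _ (leq_trans _ Mn)).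
- by move=> n; have [] := HP n.
- by have [_ _ _ _ /(_ erefl)[]] := HP k.
- by have [_ _ _ _ /(_ erefl)[]] := HP k.
Qed.

(** Refining each coordinate infinitely often makes [core_below_capn] applicable to it and puts the
    intersection of its sets inside all layers, hence inside [Y n]. *)
Definition refining (G : nat -> forall n, set (carrier (P n))) : Prop :=
  [/\ forall i, admissible (G i),
      forall i j n, (i <= j)%N -> G j n `<=` G i n
    & forall n i, exists j, [/\ (i <= j)%N,
        core_below (op (P n)) (G j.+1 n) (G j n)
        & G j.+1 n `<=` layer (P n) j]].

Lemma refining_exists k (U : set (Y k)) : open U -> (r < nu k U)%E ->
  exists2 G, refining G & trace k (G 0%N k) `<=` U.
Proof.
move=> oU rU; have [G0 aG0 G0U] := admissible_start oU rU.
(* The 2-adic valuation of [i.+1] takes each value infinitely often. *)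
have step (i : nat) (G : {G | admissible G}) :
    {G' : {G | admissible G} |
    [/\ forall n, sval G' n `<=` sval G n,
        core_below (op (P (logn 2 i.+1))) (sval G' (logn 2 i.+1))
          (sval G (logn 2 i.+1))
      & sval G' (logn 2 i.+1) `<=` layer (P (logn 2 i.+1)) i]}.
  apply: cid.
  have [G' [aG' ? ? ?]] := admissible_refine (logn 2 i.+1) i (svalP G).
  by exists (exist _ G' aG').
pose G i := iteri i (fun i (G : {G | admissible G}) => sval (step i G))
  (exist _ G0 aG0).
have GS i : G i.+1 = sval (step i (G i)) by [].
exists (fun i => sval (G i)) => //; split.
- by move=> i; exact: svalP.
- move=> i j n /subnK <-; elim: (j - i)%N => [//|l IH].
  apply: subset_trans IH; rewrite addSn GS.
  by case: (step _ _) => G' /= [+ _ _]; apply.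
(* An odd multiple of [2 ^ n] exceeding [i], shifted by one since stage [j] refines coordinate
   [logn 2 j.+1]. *)
- move=> n i; pose j := (2 ^ n * i.*2.+1).-1.
  have jE : j.+1 = (2 ^ n * i.*2.+1)%N by rewrite prednK// muln_gt0 expn_gt0.
  have nE : logn 2 j.+1 = n.
    rewrite jE lognM// ?expn_gt0// pfactorK//.
    by rewrite [logn 2 i.*2.+1]lognE dvdn2 /= odd_double addn0.
  have ij : (i <= j)%N.
    rewrite -ltnS jE (leq_trans _ (leq_pmull _ _)) ?expn_gt0//.
    by rewrite ltnS -addnn leq_addr.
  by exists j; rewrite GS; case: (step j (G j)) => G' /=; rewrite nE => -[].
Qed.

End Refinement.

Definition realize (W : set tel) : set X :=
  \bigcup_n pi n @^-1` slice W n.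

Lemma realize_raise n (U : set (Y n)) : realize (raise U) = pi n @^-1` U.
Proof.
rewrite eqEsubset; split=> [x [m _ [/= nm]]|x Ux]; first by rewrite pi_q.
by exists n => //; exists (leqnn n) => /=; rewrite q_id.
Qed.

Lemma realizeU V W : realize (V `|` W) = realize V `|` realize W.
Proof.
rewrite eqEsubset; split=> [x [n _ [Vx|Wx]]|x [[n _ Vx]|[n _ Wx]]].
- by left; exists n.
- by right; exists n.
- by exists n => //; left.
- by exists n => //; right.
Qed.

Lemma realizeI V W : tel_open V -> tel_open W ->
  realize (V `&` W) = realize V `&` realize W.
Proof.
move=> oV oW; rewrite eqEsubset.
split=> [x [n _ [Vx Wx]]|x [[m _ Vx] [n _ Wx]]].
  by split; exists n.
exists (maxn m n) => //; split.
  exact: (pi_slice oV (leq_maxl m n) Vx).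
exact: (pi_slice oW (leq_maxr m n) Wx).
Qed.

(** * The compact saturated set cut out by a refining sequence *)

Section Refined.
Variables (r : \bar R) (G : nat -> forall n, set (carrier (P n))).
Arguments G : clear implicits.
Hypothesis Gref : refining r G.

Definition limit_core : set X :=
  [set x | forall n i, trace n (G i n) (pi n x)].

Let G_open i n : op (P n) (G i n).
Proof. by case: Gref => /(_ i)[]. Qed.

Let trace_raise (W : set tel) m n i j : tel_open W ->
  (m <= n)%N -> (i <= j)%N ->
  trace m (G i m) `<=` slice W m -> trace n (G j n) `<=` slice W n.
Proof.
move=> [_ qW] mn ij GW y Gy; apply: (qW _ _ mn); apply: GW.
case: Gref => aG Gdec _; have [_ Gq _] := aG j.
by apply: Gdec ij _ _; exact: Gq mn _ Gy.
Qed.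

Let core_filter : set (set tel) :=
  [set W | tel_open W /\ exists n i, trace n (G i n) `<=` slice W n].

Let core_scott_filter : scott_filter tel_open core_filter.
Proof.
have [tT tU tI] := tel_topology; case: (Gref) => _ Gdec Gsmall.
split.
- by split=> //; exists 0%N, 0%N.
- move=> U V [_ [n [i GU]]] UV oV; split=> //.
  by exists n, i => y /GU; exact: UV.
- move=> U V [oU [m [i GU]]] [oV [n [j GV]]]; split; first exact: tI.
  exists (maxn m n), (maxn i j) => y Gy; split.
    exact: (trace_raise oU (leq_maxl m n) (leq_maxl i j) GU Gy).
  exact: (trace_raise oV (leq_maxr m n) (leq_maxr i j) GV Gy).
move=> D Dop dD [_ [n [i GD]]].
(* The cover by slices is lifted to open sets of the carrier. It covers the intersection of the
   [G j n], all of whose points come from [Y n], hence some [G j n]; then one member contains a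
   later [G l.+1 n]. *)
pose D' := [set V | op (P n) V /\ exists2 W, D W & trace n V `<=` slice W n].
have D'op : D' `<=` op (P n) by move=> V [].
have dD' : directed subset D'.
  have [_ opU _] := op_topology (P n); split.
    have [[W DW] _] := dD; exists set0; split; last by exists W.
    by rewrite -(bigcup_set0 id); exact: opU.
  move=> V1 V2 [oV1 [W1 DW1 V1W]] [oV2 [W2 DW2 V2W]].
  have [W [DW W1W W2W]] := dD.2 _ _ DW1 DW2.
  exists (V1 `|` V2); split=> //; split.
    by apply: op_setU => //; exact: op_topology.
  exists W => // y [/V1W|/V2W]; first exact: W1W.
  exact: W2W.
have [||||j GD'] := @core_below_capn _ _ (op_topology (P n)) (fun j => G j n)
    (\bigcup_(V in D') V) (op_sober (P n)) (fun j => G_open j n).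
- by move=> j1 j2; exact: Gdec.
- by move=> j; have [l [jl bl _]] := Gsmall n j; exists l.
- by have [_ opU _] := op_topology (P n); exact: opU.
- move=> s Gs; have [l|y ys] := layers_emb (P n) s.
    have [j [lj _ GL]] := Gsmall n l; apply: layer_dec lj _ _.
    by apply: GL; exact: Gs.
  have [W DW Wy] := GD y (ltac:(by rewrite /= ys; exact: Gs)).
  have [V oV VW] := (open_emb (P n) _).1 ((Dop _ DW).1 n).
  exists V; last by rewrite -ys -[V _]/(trace n V y) -VW.
  by split=> //; exists W => //; rewrite -VW.
have [l [jl bl _]] := Gsmall n j.
have [|V [oV [W DW VW]] GV] := bl D' D'op dD'.
  by apply: subset_trans GD'; exact: Gdec.
exists W => //; split; first exact: Dop.
by exists n, l.+1 => y Gy; apply: VW; exact: GV.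
Qed.

(* A maximal [tel_open] set missing the filter has prime slices, and their
   generic points are compatible by maximality. *)
Lemma limit_core_escape W : tel_open W -> ~ core_filter W ->
  exists2 x, limit_core x & ~ realize W x.
Proof.
move=> oW nFW.
have [M [[oM MT Mprime] WM nFM Mmax]] :=
  scott_filter_prime tel_topology core_scott_filter oW nFW.
have nGM n i : ~ trace n (G i n) `<=` slice M n.
  by move=> GM; apply: nFM; split=> //; exists n, i.
have Mn_prime n : prime_open open (slice M n).
  split.
  - exact: oM.1.
  - by move=> MnT; apply: (nGM n 0%N); rewrite MnT.
  - move=> U V oU oV UV.
    have below (Z : set (Y n)) : raise Z `<=` M -> Z `<=` slice M n.
      by move=> ZM y Zy; apply: ZM; exists (leqnn n); rewrite /= q_id.
    have [|UM|VM] := Mprime _ _ (tel_open_raise oU) (tel_open_raise oV).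
    + move=> [m y] [[/= nm Uy] [/= nm' Vy]].
      rewrite (bool_irrelevance nm' nm) in Vy.
      exact: (oM.2 n m nm y (UV _ (conj Uy Vy))).
    + by left; exact: below.
    + by right; exact: below.
have /(_ _)/cid-/all_sig[y yM] n := lcs_sober (P n) (Mn_prime n).
have [m n mn|x xy] := pi_point (y := y).
  apply: (emb_T0 (P m)) => U oU.
  rewrite -[U (q mn (y n))]/((q mn @^-1` U) (y n)).
  rewrite yM; last exact: q_open.
  rewrite yM//; split=> nUM UM; apply: nUM.
    by move=> z /UM; exact: oM.2 mn _.
  (* Otherwise maximality puts the union of [raise U] and [M] in the filter. From level [n] on its
     slices lie in those of [M], so [M] would be in the filter too. *)
  apply: contrapT => nUM.
  have [||_ [l [i GU]]] := Mmax (raise U); first exact: tel_open_raise.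
    move=> rUM; apply: nUM => z Uz; apply: rUM.
    by exists (leqnn m); rewrite /= q_id.
  have oUM : tel_open (raise U `|` M).
    by apply: op_setU => //; [exact: tel_topology|exact: tel_open_raise].
  have lN := leq_maxl l n; have nN := leq_maxr l n.
  apply: (nGM (maxn l n) i) => z /(trace_raise oUM lN (leqnn i) GU)[|//].
  move=> [/= mN Uz]; apply: (oM.2 _ _ nN); apply: UM => /=.
  by rewrite (q_comp _ _ mN).
exists x => [n i|[n _]]; rewrite /= xy.
  exact: (yM n _ (trace_open (G_open i n))).2 (nGM n i).
by move=> /WM My; have /(_ (fun _ => id)) := (yM n _ (oM.1 n)).1 My.
Qed.

(** A union outside the filter would miss a point of the core. So the union is in the filter, hence
    some member [W] is, and its slice contains a set [trace n (G i n)] of mass above [r]. *)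
Lemma limit_core_cover (D : set (set tel)) : D `<=` tel_open ->
  directed subset D -> limit_core `<=` realize (\bigcup_(W in D) W) ->
  exists W n, [/\ D W, (r < nu n (slice W n))%E
                & limit_core `<=` pi n @^-1` slice W n].
Proof.
move=> Dop dD QD; have [tT tU tI] := tel_topology.
have [_ _ _ Fscott] := core_scott_filter.
have [|W DW [oW [n [i GW]]]] := Fscott D Dop dD.
  apply: contrapT => /limit_core_escape[|x Qx]; first exact: tU.
  by apply; exact: QD.
exists W, n; split=> //; last by move=> x /(_ n i) /GW.
case: Gref => /(_ i) aG _ _; apply: lt_le_trans (admissible_mass n aG) _.
by apply: nu_le => //; [exact: trace_open|exact: oW.1].
Qed.

Lemma limit_core_saturated : saturated limit_core.
Proof.
exists [set V | exists n i, V = pi n @^-1` trace n (G i n)].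
  by move=> _ [n [i ->]]; apply: pi_open; exact: trace_open.
rewrite eqEsubset; split=> [x Qx _ [n [i ->]]|x Qx n i]; first exact: Qx.
by apply: (Qx (pi n @^-1` trace n (G i n))); exists n, i.
Qed.

End Refined.

(** * The limit valuation *)

Definition below (V : set X) : set (set tel) :=
  [set W | tel_open W /\ realize W `<=` V].

Lemma below_directed V : directed subset (below V).
Proof.
have [tT tU tI] := tel_topology; split.
  exists set0; split; last by move=> x [n _ []].
  by rewrite -(bigcup_set0 id); exact: tU.
move=> W1 W2 [oW1 W1V] [oW2 W2V]; exists (W1 `|` W2); split=> //.
split; first by apply: op_setU => //; exact: tel_topology.
by rewrite realizeU subUset.
Qed.

(** The largest [tel_open] set whose realization lies in [V]. *)
Definition hull (V : set X) : set tel := \bigcup_(W in below V) W.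

Lemma hull_open V : tel_open (hull V).
Proof. by have [_ tU _] := tel_topology; apply: tU => W []. Qed.

Lemma realize_hull V : open V -> realize (hull V) = V.
Proof.
move=> oV; rewrite eqEsubset; split=> [x [n _ [W [_ WV] Wx]]|x Vx].
  by apply: WV; exists n.
have [n [U [oU Ux UV]]] := pi_base oV Vx.
exists n => //; exists (raise U); last by exists (leqnn n); rewrite /= q_id.
by split; [exact: tel_open_raise|rewrite realize_raise].
Qed.

Local Open Scope ereal_scope.

Let nu_slice_le V W m n : tel_open V -> tel_open W -> (m <= n)%N ->
  slice V m `<=` slice W m -> nu m (slice V m) <= nu n (slice W n).
Proof.
move=> [oV _] [oW qW] mn VW; apply: le_trans (nu_le (oV m) (oW m) VW) _.
by rewrite -(nu_q mn)//; apply: nu_le => //; [exact: q_open].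
Qed.

Let nu_slice_ndecr W :
  tel_open W -> nondecreasing_seq (fun n => nu n (slice W n)).
Proof. by move=> oW m n mn; exact: nu_slice_le. Qed.

Lemma core_exists r k (U : set (Y k)) : open U -> r < nu k U ->
  exists Q, [/\ saturated Q, Q `<=` pi k @^-1` U
    & forall D : set (set tel), D `<=` tel_open -> directed subset D ->
      Q `<=` realize (\bigcup_(W in D) W) ->
      exists W n, [/\ D W, r < nu n (slice W n) & Q `<=` pi n @^-1` slice W n]].
Proof.
move=> oU /(refining_exists oU)[G Gref GU]; exists (limit_core G); split.
- exact: limit_core_saturated Gref.
- by move=> x Qx; apply: GU; exact: Qx.
- exact: limit_core_cover.
Qed.

(** The slice of the hull at [n] is the largest open set whose preimage under [pi n] lies in [V], so
    this is the supremum of the masses of the basic open subsets of [V]. *)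
Definition limit_valuation (V : set X) : \bar R :=
  ereal_sup (range (fun n => nu n (slice (hull V) n))).

Lemma limit_valuation_ge V W n : below V W ->
  nu n (slice W n) <= limit_valuation V.
Proof.
move=> WV; apply: (@le_trans _ _ (nu n (slice (hull V) n))).
  apply: nu_slice_le => //; [by case: WV|exact: hull_open|].
  by move=> y Wy; exists W.
by apply: ereal_sup_ubound; exists n.
Qed.

(** Projections need not be onto, so slices of the hull may exceed the pullbacks of [U]. If one had
    mass above [nu n U], its core would be covered by [raise U] alone, and some slice of [raise U]
    would have mass above [nu n U]; but each is empty or a pullback of [U]. *)
Lemma limit_valuation_pi n (U : set (Y n)) :
  open U -> limit_valuation (pi n @^-1` U) = nu n U.
Proof.
move=> oU; have oUr := tel_open_raise oU.
have sU : slice (raise U) n = U.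
  by rewrite (slice_raise _ (leqnn n)) eqEsubset; split=> y /=; rewrite q_id.
have bU : below (pi n @^-1` U) (raise U) by split; rewrite ?realize_raise.
apply/eqP; rewrite eq_le; apply/andP; split; last first.
  by rewrite -{1}sU; exact: limit_valuation_ge.
apply: ge_ereal_sup => _ [m _ <-]; rewrite leNgt; apply/negP.
move=> /(core_exists ((hull_open _).1 m))[Q [_ QU /(_ [set raise U])[]]].
- by move=> _ ->.
- exact: directed1.
- rewrite bigcup_set1 realize_raise => x /QU Hx.
  by rewrite -(realize_hull (pi_open oU)); exists m.
move=> _ [l [-> + _]]; apply/negP; rewrite -leNgt.
have [nl|ln] := leqP n l.
  by rewrite slice_raise -[nu l _]/(image_valuation _ _ _) nu_q.
rewrite slice_raise0//; have [[_ -> _ _] _] := nu_cont l.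
by have [[nu0 _ _ _] _] := nu_cont n; exact: nu0.
Qed.

(** Common source of Scott continuity and tightness: the cover [D] is replaced by the directed
    family of all [tel_open] sets below its members, to which [core_exists] applies. *)
Lemma limit_valuation_support V r : open V -> r < limit_valuation V ->
  exists Q, [/\ saturated Q, Q `<=` V
    & forall D : set (set X), D `<=` open -> directed subset D ->
      Q `<=` \bigcup_(U in D) U ->
      exists U, [/\ D U, Q `<=` U & r < limit_valuation U]].
Proof.
move=> oV /ereal_sup_gt[_ [n _ <-]] /(core_exists ((hull_open _).1 n)).
move=> [Q [satQ QV Qcover]]; exists Q; split=> //.
  by move=> x /QV Vx; rewrite -(realize_hull oV); exists n.
move=> D Dop dD QD.
have [|||W [m [[U DU [oW WU]] rW QW]]] := Qcover (\bigcup_(U in D) below U).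
- by move=> W [U _ []].
- split.
    have [[U DU] _] := dD; have [[W UW] _] := below_directed U.
    by exists W, U.
  move=> W1 W2 [U1 DU1 [oW1 WU1]] [U2 DU2 [oW2 WU2]].
  have [U [DU U1U U2U]] := dD.2 _ _ DU1 DU2.
  have [|//|W [UW W1W W2W]] := (below_directed U).2 W1 W2.
  + by split=> //; exact: subset_trans U1U.
  + by split=> //; exact: subset_trans U2U.
  + by exists W; split=> //; exists U.
- move=> x /QD[U DU Ux]; have := Ux; rewrite -(realize_hull (Dop _ DU)).
  by move=> [m _ [W UW Wx]]; exists m => //; exists W => //; exists U.
exists U; split=> //; first by move=> x /QW Wx; apply: WU; exists m.
by apply: lt_le_trans rW _; exact: limit_valuation_ge.
Qed.

Lemma limit_valuation_le U V : open U -> open V -> U `<=` V ->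
  limit_valuation U <= limit_valuation V.
Proof.
move=> oU oV UV; apply: ge_ereal_sup => _ [n _ <-].
apply: limit_valuation_ge; split; first exact: hull_open.
by rewrite realize_hull.
Qed.

Lemma limit_valuation_scott (D : set (set X)) : D `<=` open ->
  directed subset D ->
  limit_valuation (\bigcup_(U in D) U) = ereal_sup (limit_valuation @` D).
Proof.
move=> Dop dD.
have oD : open (\bigcup_(U in D) U) by apply: bigcup_open => U /Dop.
apply/eqP; rewrite eq_le; apply/andP; split; last first.
  apply: ge_ereal_sup => _ [U DU <-]; apply: limit_valuation_le => //.
    exact: Dop.
  by move=> x Ux; exists U.
rewrite leNgt; apply/negP => /(limit_valuation_support oD)[Q [_ QD]].
move=> /(_ D Dop dD QD)[U [DU _]]; apply/negP; rewrite -leNgt.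
by apply: ereal_sup_ubound; exists U.
Qed.

(** The realization is the directed union of the cylinders over the slices. For general [mu] this
    yields uniqueness; for the limit valuation, the convergence behind modularity. *)
Lemma valuation_realize (mu : set X -> \bar R) (W : set tel) :
  (forall D : set (set X), D `<=` open -> directed subset D ->
    mu (\bigcup_(U in D) U) = ereal_sup (mu @` D)) ->
  (forall n U, open U -> mu (pi n @^-1` U) = nu n U) ->
  tel_open W ->
  mu (realize W) = ereal_sup (range (fun n => nu n (slice W n))).
Proof.
move=> mu_scott mu_pi oW.
have -> : realize W =
    \bigcup_(U in range (fun n => pi n @^-1` slice W n)) U.
  by rewrite bigcup_image.
rewrite mu_scott.
- congr ereal_sup; rewrite image_comp; apply: eq_imagel => n _ /=.
  by apply: mu_pi; exact: oW.1.
- by move=> _ [n _ <-]; apply: pi_open; exact: oW.1.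
- split; first by exists (pi 0%N @^-1` slice W 0%N), 0%N.
  move=> _ _ [m _ <-] [n _ <-].
  exists (pi (maxn m n) @^-1` slice W (maxn m n)); split.
  + by exists (maxn m n).
  + by move=> x; apply: pi_slice => //; exact: leq_maxl.
  + by move=> x; apply: pi_slice => //; exact: leq_maxr.
Qed.

Lemma limit_valuation_cvg W : tel_open W ->
  nu n (slice W n) @[n --> \oo] --> limit_valuation (realize W).
Proof.
move=> oW; rewrite valuation_realize//.
- exact: ereal_nondecreasing_cvgn (nu_slice_ndecr oW).
- exact: limit_valuation_scott.
- exact: limit_valuation_pi.
Qed.

Lemma limit_valuation_ge0 V : 0 <= limit_valuation V.
Proof.
apply: (@le_trans _ _ (nu 0%N (slice (hull V) 0%N))).
  by have [[+ _ _ _] _] := nu_cont 0%N; apply; exact: (hull_open V).1.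
by apply: ereal_sup_ubound; exists 0%N.
Qed.

Lemma limit_valuation_continuous : continuous_valuation limit_valuation.
Proof.
split; last exact: limit_valuation_scott.
split.
- by move=> U _; exact: limit_valuation_ge0.
- rewrite -(preimage_set0 (pi 0%N)) limit_valuation_pi; last exact: open0.
  by have [[_ -> _ _] _] := nu_cont 0%N.
- exact: limit_valuation_le.
(* Modularity passes to the limit from the levels. Union and intersection of the hulls of [U] and
   [V] replace the hulls of union and intersection: they have the right realizations, and their
   slices are exactly unions and intersections. *)
move=> U V oU oV; have hU := hull_open U; have hV := hull_open V.
have [_ _ tI] := tel_topology.
have hUV : tel_open (hull U `|` hull V).
  by apply: op_setU => //; exact: tel_topology.
have rUV : realize (hull U `|` hull V) = U `|` V.
  by rewrite realizeU !realize_hull.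
have rUiV : realize (hull U `&` hull V) = U `&` V.
  by rewrite realizeI// !realize_hull.
have cU := limit_valuation_cvg hUV; rewrite rUV in cU.
have cI := limit_valuation_cvg (tI _ _ hU hV); rewrite rUiV in cI.
have := limit_valuation_cvg hU; rewrite realize_hull// => c1.
have := limit_valuation_cvg hV; rewrite realize_hull// => c2.
have dA A B : limit_valuation A +? limit_valuation B.
  by apply: ge0_adde_def; rewrite inE limit_valuation_ge0.
have c12 := cvgeD (dA _ _) c1 c2.
apply: (@cvg_unique _ (@ereal_hausdorff R) _ _ _ _ _ (c12 _)) => //.
apply: cvg_trans (cvgeD (dA _ _) cU cI).
apply: near_eq_cvg; apply: nearW => n /=.
have [[_ _ _ +] _] := nu_cont n; apply.
- exact: hU.1.
- exact: hV.1.
Qed.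

Lemma limit_valuation_unique mu : continuous_valuation mu ->
  (forall n U, open U -> mu (pi n @^-1` U) = nu n U) ->
  eq_on_open mu limit_valuation.
Proof.
move=> [_ mu_scott] mu_pi V oV; rewrite -{1}(realize_hull oV).
by rewrite (valuation_realize mu_scott mu_pi (hull_open V)).
Qed.

Lemma limit_valuation_tight : tight limit_valuation.
Proof.
move=> V oV r r0 [->|rV].
  exists set0; split=> //; first exact: compact0.
    exists [set set0]; first by move=> _ ->; exact: open0.
    by rewrite bigcap_set1.
  by apply: le_ereal_inf_tmp => _ [U _ <-]; exact: limit_valuation_ge0.
have [Q [satQ QV Qcover]] := limit_valuation_support oV rV.
exists Q; split=> //.
  apply: compact_directed => D Dop dD QD.
  by have [U [DU QU _]] := Qcover D Dop dD QD; exists U.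
apply: le_ereal_inf_tmp => _ [U [oU QU] <-].
have [|||_ [-> _ /ltW//]] := Qcover [set U].
- by move=> _ ->.
- exact: directed1.
- by rewrite bigcup_set1.
Qed.

End ProjectiveSequence.

(** An alias indexed by [opP], so that its topology does not clash with one already on [T]. *)
Definition generated_space {T : Type} {op : set (set T)}
  (opP : is_topology op) : Type := T.

Section GeneratedSpace.
Context {T : choiceType} {op : set (set T)} (opP : is_topology op).

Let opT : op setT. Proof. by case: opP. Qed.

Let opI : setI_closed op. Proof. by case: opP. Qed.

Let op_bigU (J : Type) (f : J -> set T) :
  (forall j, op (f j)) -> op (\bigcup_j f j).
Proof.
case: opP => _ opU _ opf.
by rewrite -(bigcup_image setT f id); apply: opU => _ [j _ <-].
Qed.

HB.instance Definition _ := Choice.on (generated_space opP).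
HB.instance Definition _ :=
  isOpenTopological.Build (generated_space opP) opT opI op_bigU.

End GeneratedSpace.

(** * Points and base of a projective limit, and cofinal sequences *)

Section ProjectiveLimit.
Context {disp : Order.disp_t} {I : preorderType disp}
  (X_ : I -> topologicalType)
  (p_ : forall i j : I, (i <= j)%O -> X_ j -> X_ i)
  (X : topologicalType) (p : forall i, X -> X_ i).
Hypothesis sysP : projective_system p_.
Hypothesis limP : projective_limit p_ p.

Lemma projective_limit_point (y : forall i, X_ i) :
  (forall i j (ij : (i <= j)%O), p_ ij (y j) = y i) ->
  exists x, forall i, p i x = y i.
Proof.
(* The constant maps from [bool] form a cone, whose mediating map takes the wanted point as its
   value. *)
move=> yP; have [|h [[_ hy] _]] := limP.2 bool (fun i => cst (y i)).
  by split=> [i|i j ij b]; [exact: cst_continuous|exact: yP].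
by exists (h true) => i; exact: hy.
Qed.

(* The limit topology is initial for the projections: retopologise [X] by it
   and compare the mediating map with the identity. *)
Lemma projective_limit_base (W : set X) x : open W -> W x ->
  exists i (U : set (X_ i)), [/\ open U, U (p i x) & p i @^-1` U `<=` W].
Proof.
move=> oW Wx; have [[[i0 _] dirI] p_cont _ _] := sysP.
have [[p_c pp] univ] := limP.
pose op := [set V : set X | forall z, V z ->
  exists i (U : set (X_ i)), [/\ open U, U (p i z) & p i @^-1` U `<=` V]].
have opP : is_topology op.
  split.
  - by move=> z _; exists i0, setT; split=> //; exact: openT.
  - move=> D Dop z [V DV Vz]; have [i [U [oU Uz UV]]] := Dop _ DV _ Vz.
    by exists i, U; split=> // t /UV Vt; exists V.
  - move=> V1 V2 oV1 oV2 z [Vz1 Vz2].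
    have [i [U1 [oU1 Uz1 UV1]]] := oV1 _ Vz1.
    have [j [U2 [oU2 Uz2 UV2]]] := oV2 _ Vz2.
    have [k [_ ik jk]] := dirI i j Logic.I Logic.I.
    exists k, (p_ ik @^-1` U1 `&` p_ jk @^-1` U2); split.
    + apply: openI.
        by apply: preimage_open _ oU1; exact: p_cont.
      by apply: preimage_open _ oU2; exact: p_cont.
    + by split=> /=; [rewrite -(pp i k ik) in Uz1|rewrite -(pp j k jk) in Uz2].
    + move=> t [/= U1t U2t]; split; [apply: UV1|apply: UV2] => /=.
        by rewrite -(pp i k ik).
      by rewrite -(pp j k jk).
have [|h [[h_cont hp] _]] := univ (generated_space opP) p.
  split; last exact: pp.
  move=> i; apply/continuousP => U oU; change (op (p i @^-1` U)) => z Uz.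
  by exists i, U; split.
have id_cont : continuous (id : X -> generated_space opP).
  apply/continuousP => V oV.
  have -> : id @^-1` V = \bigcup_(U in [set U : set X | open U /\ U `<=` V]) U.
    rewrite eqEsubset; split=> [z Vz|z [U [_ UV] Uz]]; last exact: UV.
    have [i [U [oU Uz UV]]] := oV z Vz.
    exists (p i @^-1` U) => //; split=> //.
    by apply: preimage_open _ oU; exact: p_c.
  by apply: bigcup_open => U [].
(* The identity and [h] both mediate from [X] to itself, so [h] is the identity; its continuity
   makes [W] open for the initial topology. *)
have [g [_ guniq]] := univ X p (conj p_c pp).
have gid : g = id by apply: guniq; split=> // z; exact: cvg_id.
have gh : g = h.
  apply: guniq; split; last exact: hp.
  move=> z; apply: (@continuous_comp X (generated_space opP) X id h z).
    exact: id_cont.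
  exact: h_cont.
have hid : h = id by rewrite -gh.
have oW' : @open (generated_space opP) (h @^-1` W).
  exact: preimage_open h_cont oW.
by move: oW' Wx; rewrite hid; apply.
Qed.

(** Step [n] moves above the current index and above the element of [J] numbered [n], if any, so [j]
    is dominated at [(f j).+1]. *)
Lemma cofinal_sequence (J : set I) : countable J ->
  cofinal (fun i j : I => (i <= j)%O) J ->
  exists s : nat -> I, (forall m n, (m <= n)%N -> (s m <= s n)%O) /\
    forall i, exists n, (i <= s n)%O.
Proof.
move=> /countable_injP[f finj] cofJ; have [[[i0 _] dirI] _ _ _] := sysP.
have step n i : {k | (i <= k)%O /\ forall j, J j -> f j = n -> (j <= k)%O}.
  apply: cid; have [[j [Jj fj]]|nj] := pselect (exists j, J j /\ f j = n).
    have [k [_ ik jk]] := dirI i j Logic.I Logic.I.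
    exists k; split=> // j' Jj' fj'.
    by rewrite (finj j' j) ?inE// fj' fj.
  by exists i; split=> // j Jj fj; exfalso; apply: nj; exists j.
pose s n := iteri n (fun n i => sval (step n i)) i0.
exists s; split.
  apply: (@homo_leq _ s (fun i j => i <= j)%O) => [i|j i k|n].
  - exact: lexx.
  - exact: le_trans.
  - by rewrite {2}/s /=; case: (step _ _) => k [].
move=> i; have [j Jj ij] := cofJ i; exists (f j).+1.
apply: le_trans ij _; rewrite /s /=.
exact: (svalP (step (f j) _)).2 j Jj erefl.
Qed.

End ProjectiveLimit.

Theorem corollary9p5 (R : realType) (disp : Order.disp_t)
    (I : preorderType disp) (X_ : I -> topologicalType)
    (nu_ : forall i, set (X_ i) -> \bar R)
    (p_ : forall i j : I, (i <= j)%O -> X_ j -> X_ i)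
    (X : topologicalType) (p : forall i, X -> X_ i)
    (d : forall i, X_ i -> X_ i -> \bar R) :
  projective_system_of_valued_spaces p_ nu_ ->
  projective_limit p_ p ->
  (exists J : set I, countable J /\ cofinal (fun i j : I => (i <= j)%O) J) ->
  (forall i, locally_finite (nu_ i)) ->
  (forall i, [/\ quasi_metric (d i), continuous_complete (d i)
               & forall U : set (X_ i), open U <-> d_scott_open (d i) U]) ->
  exists nu : set X -> \bar R,
    [/\ continuous_valuation nu,
        forall i, eq_on_open (nu_ i) (image_valuation (p i) nu),
        forall mu : set X -> \bar R,
          continuous_valuation mu ->
          (forall i, eq_on_open (nu_ i) (image_valuation (p i) mu)) ->
          eq_on_open mu nu
      & tight nu].
Proof.
move=> [sysP nuV nu_p] limP [J [cJ cofJ]] _ dP.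
have [_ p_cont p_id p_comp] := sysP; have [[p_c pp] _] := limP.
have [s [smono scof]] := cofinal_sequence sysP cJ cofJ.
pose Y n := X_ (s n).
pose q m n (mn : (m <= n)%N) : Y n -> Y m := p_ _ _ (smono m n mn).
pose pi n : X -> Y n := p (s n).
pose P n : lcs_presentation (Y n) :=
  let: And3 qd cd dopen := dP (s n) in formal_ball_presentation qd cd dopen.
have q_cont m n (mn : (m <= n)%N) : continuous (q m n mn) by exact: p_cont.
have q_id n (nn : (n <= n)%N) y : q n n nn y = y by exact: p_id.
have q_comp l m n (lm : (l <= m)%N) (mn : (m <= n)%N) (ln : (l <= n)%N) y :
  q l m lm (q m n mn y) = q l n ln y by exact: p_comp.
have nu_q m n (mn : (m <= n)%N) :
  eq_on_open (image_valuation (q m n mn) (nu_ (s n))) (nu_ (s m)).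
  exact: nu_p.
have pi_c n : continuous (pi n) by exact: p_c.
have pi_q m n (mn : (m <= n)%N) x : q m n mn (pi n x) = pi m x by exact: pp.
have pi_point (y : forall n, Y n) :
    (forall m n (mn : (m <= n)%N), q m n mn (y n) = y m) ->
    exists x, forall n, pi n x = y n.
  move=> yP.
  (* A compatible sequence extends to all indices, since the component at [i] is the same computed
     from any level above [i]. *)
  have val_eq i m n (im : (i <= s m)%O) (jn : (i <= s n)%O) :
      p_ _ _ im (y m) = p_ _ _ jn (y n).
    have ik : (i <= s (maxn m n))%O := le_trans im (smono _ _ (leq_maxl m n)).
    rewrite -(yP _ _ (leq_maxl m n)) -(yP _ _ (leq_maxr m n)) /q.
    have := p_comp _ _ _ im (smono _ _ (leq_maxl m n)) ik (y (maxn m n)).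
    have := p_comp _ _ _ jn (smono _ _ (leq_maxr m n)) ik (y (maxn m n)).
    by move=> /= -> ->.
  pose N i := sval (cid (scof i)).
  have iN i : (i <= s (N i))%O by exact: (svalP (cid (scof i))).
  have [|x xP] :=
    projective_limit_point limP (y := fun i => p_ _ _ (iN i) (y (N i))).
    move=> i j ij; have ijN := le_trans ij (iN j).
    have /= -> := p_comp _ _ _ ij (iN j) ijN (y (N j)).
    exact: val_eq.
  exists x => n; rewrite /pi xP (val_eq _ _ n _ (lexx _)).
  exact: p_id.
have pi_base (W : set X) x : open W -> W x ->
    exists n (U : set (Y n)), [/\ open U, U (pi n x) & pi n @^-1` U `<=` W].
  move=> oW Wx.
  have [i [U [oU Ux UW]]] := projective_limit_base sysP limP oW Wx.
  have [n in_] := scof i; exists n, (p_ _ _ in_ @^-1` U).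
  have pE z : p_ _ _ in_ (p (s n) z) = p i z by exact: pp.
  split; first by apply: preimage_open _ oU; exact: p_cont.
    by rewrite /= /pi pE.
  by move=> z /=; rewrite /pi pE; exact: UW.
pose nuY n := nu_ (s n).
have nuYV n : continuous_valuation (nuY n) by exact: nuV.
have nu_lim i : eq_on_open (nu_ i)
    (image_valuation (p i) (limit_valuation q nuY pi)).
  move=> U oU; have [n in_] := scof i.
  have oU' : open (p_ _ _ in_ @^-1` U).
    by apply: preimage_open _ oU; exact: p_cont.
  rewrite -(nu_p _ _ in_ _ oU) /image_valuation.
  rewrite -[nu_ (s n) _]/(nuY n _).
  rewrite -(limit_valuation_pi P q_cont q_id q_comp nuYV nu_q pi_c
                               pi_q pi_point pi_base oU').
  congr limit_valuation; apply/funext => z.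
  by rewrite /= /pi -(pp _ _ in_).
exists (limit_valuation q nuY pi); split=> //.
- exact: (limit_valuation_continuous P).
- move=> mu mu_cont mu_p.
  apply: (limit_valuation_unique (q := q) (nu := nuY) (pi := pi)) => //.
  by move=> n U oU; rewrite -[mu _]/(image_valuation (p (s n)) mu U) -mu_p.
- exact: (limit_valuation_tight P).
Qed.
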